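(* Let $\mathcal{L}=(\bm{X},\bm{E},\bm{F},\mathbb{P}_{\bm{E}})$ and $\mathcal{H}=(\bm{Y},\bm{U},\bm{G},\mathbb{P}_{\bm{U}})$ be structural causal models with sets of admissible interventions $\mathcal{I}$ and $\mathcal{J}$ respectively (soft interventions, with hard interventions as a special case, in any combination). Whenever $\mathcal{H}$ is a soft $\tau$-abstraction of $\mathcal{L}$, the intervention map $\omega\colon\mathcal{I}\to\mathcal{J}$ is unique. That is, if $\omega,\omega'\colon\mathcal{I}\to\mathcal{J}$ are surjective functions that both satisfy the conditions in the definition of soft $\tau$-abstraction (for the same $\tau_{\bm{Y}},\tau_{\bm{U}}$), then $\omega=\omega'$.
   Context: Each variable $V$ has a domain $\mathrm{Val}(V)$; for a set $\bm{V}$ of variables, $\mathrm{Val}(\bm{V})=\prod_{V\in\bm{V}}\mathrm{Val}(V)$. For $\bm{V}\subseteq\bm{X}$ and $\bm{x}\in\mathrm{Val}(\bm{X})$, $\mathrm{Proj}(\bm{x},\bm{V})\in\mathrm{Val}(\bm{V})$ is the restriction of $\bm{x}$ to the variables $\bm{V}$. A structural causal model (SCM) is a tuple $\mathcal{M}=(\bm{X},\bm{E},\bm{F},\mathbb{P}_{\bm{E}})$ with a set $\bm{X}$ of endogenous variables, a set $\bm{E}$ of exogenous variables, a set $\bm{F}$ of functions (structural equations) $F_X\colon\mathrm{Val}(\bm{X})\times\mathrm{Val}(\bm{E})\to\mathrm{Val}(X)$, one for each $X\in\bm{X}$, and a probability measure $\mathbb{P}_{\bm{E}}$ on $\mathrm{Val}(\bm{E})$.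 Each $F_X$ depends only on a subset $\mathrm{Pa}(X)\subseteq\bm{X}\cup\bm{E}$ of variables, the parents of $X$. Endogenous settings are fully determined by exogenous settings, so each model can be considered as a function $\mathcal{M}\colon\mathrm{Val}(\bm{E})\to\mathrm{Val}(\bm{X})$. A soft intervention $i=(\bm{V}\gets\bm{f})$ on $\mathcal{M}$ is given by a subset $\bm{V}\subseteq\bm{X}$ and a set of functions $\bm{f}=\{f_X\}_{X\in\bm{V}}$, where each $f_X\colon\mathrm{Val}(\bm{X})\times\mathrm{Val}(\bm{E})\to\mathrm{Val}(X)$ depends at most on the parents $\mathrm{Pa}(X)$ in the non-intervened model. It produces the SCM $\mathcal{M}_i=(\bm{X},\bm{E},\bm{F}^i,\mathbb{P}_{\bm{E}})$ with $F^i_X=f_X$ if $X\in\bm{V}$ and $F^i_X=F_X$ otherwise. Hard interventions are the special case in which all $f_X$ are constant. Viewing $\bm{f}$ as a joint function $\mathrm{Val}(\bm{X})\times\mathrm{Val}(\bm{E})\to\mathrm{Val}(\bm{V})$, the soft restriction set of $i=(\bm{V}\gets\bm{f})$ is $$\mathrm{SoftRst}(\mathcal{M}_i)=\{\bm{x}\in\mathrm{Val}(\bm{X})\mid\mathrm{Proj}(\bm{x},\bm{V})\in\mathrm{Image}(\bm{f})\}.$$ The structural equations $\bm{F}^i$ are also viewed as a joint function $\mathrm{Val}(\bm{X})\times\mathrm{Val}(\bm{E})\to\mathrm{Val}(\bm{X})$, and similarly $\bm{G}^{j}$ for an intervention $j$ on $\mathcal{H}$. Soft abstraction: let $\tau_{\bm{Y}}\colon\mathrm{Val}(\bm{X})\to\mathrm{Val}(\bm{Y})$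 and $\tau_{\bm{U}}\colon\mathrm{Val}(\bm{E})\to\mathrm{Val}(\bm{U})$ be surjective functions. $\mathcal{H}$ is a soft $\tau$-abstraction of $\mathcal{L}$ whenever there exists a surjective function $\omega\colon\mathcal{I}\to\mathcal{J}$ (the intervention map) such that, for every $i\in\mathcal{I}$, $$\mathrm{SoftRst}(\mathcal{H}_{\omega(i)})=\{\tau_{\bm{Y}}(\bm{x})\mid\bm{x}\in\mathrm{SoftRst}(\mathcal{L}_i)\}$$ and, for every $\bm{e}\in\mathrm{Val}(\bm{E})$ and $\bm{x}\in\mathrm{Val}(\bm{X})$, $$\tau_{\bm{Y}}(\bm{F}^i(\bm{x},\bm{e}))=\bm{G}^{\omega(i)}(\tau_{\bm{Y}}(\bm{x}),\tau_{\bm{U}}(\bm{e})).$$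
   Formalization: Uniqueness fails if J holds distinct interventions with the same model and soft restriction set (e.g. the empty one and X←F_X with F_X onto). Proved: ω(i), ω'(i) always agree in both; ω=ω' is concluded only when no two distinct members of J agree in both. *)

(* Defs.v *)
From mathcomp Require Import all_boot all_order all_algebra.
From mathcomp Require Import all_classical all_reals all_analysis.

Set Implicit Arguments.
Unset Strict Implicit.
Unset Printing Implicit Defensive.

Local Open Scope classical_set_scope.

Definition Val (V : Type) (dom : V -> Type) : Type := forall v, dom v.

Definition Proj (X : Type) (dom : X -> Type) (x : Val dom) (V : set X) :
  Val (fun v : V => dom (\val v)) := fun v => x (\val v).
Arguments Proj {X dom} x V _ : assert.

Section SCM.
Context (R : realType) (X E : Type) (dX : X -> Type) (dE : E -> pointedType).

Definition depends_only_on (B : Type) (f : Val dX -> Val dE -> B)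
    (P : set (X + E)) : Prop :=
  forall x x' e e',
    (forall v, P (inl v) -> x v = x' v) ->
    (forall v, P (inr v) -> e v = e' v) ->
    f x e = f x' e'.

(* [exo_events] generates the sigma-algebra on [Val dE] carrying the
   probability measure; since it is arbitrary, so is the sigma-algebra.
   The domains of the exogenous variables are pointed because the library's
   measurable types are; this loses nothing, as a space carrying a probability
   measure is nonempty. *)
Record scm := Scm {
  parents : X -> set (X + E);
  equation : forall v : X, Val dX -> Val dE -> dX v;
  equation_parents : forall v, depends_only_on (equation v) (parents v);
  equation_determined :
    forall e, exists! x : Val dX, forall v, equation v x e = x v;
  exo_events : set (set (Val dE));
  exo_prob : probability (g_sigma_algebraType exo_events) R
}.

Definition joint_equation (M : scm) (x : Val dX) (e : Val dE) : Val dX :=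
  fun v => equation M v x e.

Definition replace_equation (M : scm) (V : set X)
    (f : forall v : V, Val dX -> Val dE -> dX (\val v))
    (v : X) : Val dX -> Val dE -> dX v :=
  match pselect (V v) with
  | left h => f (SigSub (mem_set h))
  | right _ => equation M v
  end.

(* The last field says that the intervened equations again determine the
   endogenous variables, i.e. that the intervention yields an SCM. *)
Record intervention (M : scm) := Intervention {
  targets : set X;
  mechanism : forall v : targets, Val dX -> Val dE -> dX (\val v);
  mechanism_parents :
    forall v : targets, depends_only_on (mechanism v) (parents M (\val v));
  intervention_determined :
    forall e, exists! x : Val dX, forall v,
      replace_equation M mechanism v x e = x v
}.

Lemma replace_equation_parents (M : scm) (i : intervention M) (v : X) :
  depends_only_on (replace_equation M (@mechanism M i) v) (parents M v).
Proof.
rewrite /replace_equation; case: pselect => [h|_].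
  exact: (@mechanism_parents M i (SigSub (mem_set h))).
exact: equation_parents.
Qed.

Definition intervene (M : scm) (i : intervention M) : scm :=
  @Scm (parents M) (replace_equation M (@mechanism M i))
    (replace_equation_parents i) (@intervention_determined M i)
    (exo_events M) (exo_prob M).

Definition joint_mechanism (M : scm) (i : intervention M)
    (x : Val dX) (e : Val dE) : Val (fun v : targets i => dX (\val v)) :=
  fun v => mechanism v x e.
Arguments joint_mechanism {M} i x e _ : assert.

Definition SoftRst (M : scm) (i : intervention M) : set (Val dX) :=
  [set x | exists x' e, Proj x (targets i) = joint_mechanism i x' e].

(* Interventions are compared by what they do. Equality of the pairs
   [(targets, mechanism)] is finer: replacing a surjective mechanism by itself
   gives the same model and the same soft restriction set as intervening on
   nothing, and the conditions on an intervention map below involve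
   interventions on the abstract model only through these two objects. *)
Definition same_intervention (M : scm) (i j : intervention M) : Prop :=
  intervene i = intervene j /\ SoftRst i = SoftRst j.

End SCM.

Definition intervention_map (R : realType) (X E Y U : Type)
    (dX : X -> Type) (dE : E -> pointedType)
    (dY : Y -> Type) (dU : U -> pointedType)
    (L : scm R dX dE) (H : scm R dY dU)
    (I : set (intervention L)) (J : set (intervention H))
    (tauY : Val dX -> Val dY) (tauU : Val dE -> Val dU)
    (omega : I -> J) : Prop :=
  [/\ set_surj [set: I] [set: J] omega,
      forall i : I,
        SoftRst (\val (omega i)) = tauY @` SoftRst (\val i) &
      forall (i : I) (e : Val dE) (x : Val dX),
        tauY (joint_equation (intervene (\val i)) x e) =
        joint_equation (intervene (\val (omega i))) (tauY x) (tauU e)].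

(* Main.v *)
Require Import Defs.
From mathcomp Require Import all_boot all_order all_algebra.
From mathcomp Require Import all_classical all_reals all_analysis.

Local Open Scope classical_set_scope.

(** Since [tauY] and [tauU] are surjective, the commutation condition fixes the
    intervened equations of the abstract model at every argument, and the other
    condition fixes the soft restriction set outright; so both depend on [i] and
    [tau] only. *)

(** [intervene] keeps the parents and the exogenous probability of [M], so two results can differ
    only in their equations, which are the components of the joint one, and in proofs, which are
    irrelevant. *)
Lemma eq_intervene (R : realType) (X E : Type) (dX : X -> Type)
    (dE : E -> pointedType) (M : scm R dX dE) (i j : intervention M) :
  joint_equation (intervene i) = joint_equation (intervene j) ->
  intervene i = intervene j.
Proof.
move=> eqij.
have eqF : replace_equation M (@mechanism _ _ _ _ _ _ i) =
           replace_equation M (@mechanism _ _ _ _ _ _ j).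
  apply: functional_extensionality_dep => v.
  apply/funext => x; apply/funext => e.
  exact: (f_equal (fun F => F x e v) eqij).
rewrite /intervene.
(* The types of these two proof fields mention the equations, so the proofs are generalized for the
   rewrite to stay well typed. *)
move: (replace_equation_parents i) (@intervention_determined _ _ _ _ _ _ i).
rewrite eqF => parents_i determined_i.
by rewrite (Prop_irrelevance parents_i (replace_equation_parents j))
           (Prop_irrelevance determined_i (@intervention_determined _ _ _ _ _ _ j)).
Qed.

(** If [J] holds two distinct interventions with the same effect, exchanging them in [omega]
    preserves both conditions; hence equality of the maps is stated for [J] without such
    duplicates. *)
Theorem mainTheorem3 (R : realType) (X E Y U : Type)
    (dX : X -> Type) (dE : E -> pointedType)
    (dY : Y -> Type) (dU : U -> pointedType)
    (L : scm R dX dE) (H : scm R dY dU)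
    (I : set (intervention L)) (J : set (intervention H))
    (tauY : Val dX -> Val dY) (tauU : Val dE -> Val dU)
    (tauY_surj : set_surj [set: Val dX] [set: Val dY] tauY)
    (tauU_surj : set_surj [set: Val dE] [set: Val dU] tauU)
    (omega omega' : I -> J)
    (omega_map : intervention_map tauY tauU omega)
    (omega'_map : intervention_map tauY tauU omega') :
  (forall i : I, same_intervention (\val (omega i)) (\val (omega' i))) /\
  ((forall j j' : J, same_intervention (\val j) (\val j') -> j = j') ->
   omega = omega').
Proof.
have same i : same_intervention (\val (omega i)) (\val (omega' i)).
  have [_ rst com] := omega_map; have [_ rst' com'] := omega'_map.
  split; last by rewrite rst rst'.
  apply: eq_intervene; apply/funext => y; apply/funext => u.
  have [x _ <-] := tauY_surj y Logic.I; have [e _ <-] := tauU_surj u Logic.I.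
  by rewrite -com -com'.
by split=> // inj; apply/funext => i; exact: inj.
Qed.
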